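(* Let $p$ and $q$ be distinct primes, let $P$ be an elementary abelian group of order $p^{\alpha}$ and $Q$ an elementary abelian group of order $q^{\beta}$, and let $G = P \rtimes_{\theta} Q$. Let $P_1,\ldots,P_r$ be pairwise non-isomorphic irreducible $\mathbb{Z}_pQ$-modules and let $P = U_1 \times \cdots \times U_r$, where $U_i$ is an isotypic $\mathbb{Z}_pQ$-submodule of $P$ of type $P_i$ and multiplicity $m_i$ for $1 \leq i \leq r$. Let $S$ be a normal subgroup of $G$. Then one of the following holds. (i) $S \leq P$ is a $\mathbb{Z}_pQ$-submodule of $P$. Further, there exists a subset $\{i_1,\ldots,i_s\}$ of $\{1,\ldots,r\}$ such that $S = M_{i_1} \times \cdots \times M_{i_s}$, where each $M_{i_j} \leq U_{i_j}$ is a direct sum of isomorphic $\mathbb{Z}_pQ$-submodules of type $P_{i_j}$. (ii) $S \leq \mathrm{Ker}(\theta)$. (iii) $S = \hat{P} \rtimes \hat{Q}$, where $\hat{P} \leq P$ is a $\mathbb{Z}_pQ$-submodule of $P$ containing a complement of $C_P(\hat{Q})$ in $P$, and $\hat{Q}$ is a subgroup of $Q$. Further, there exists a subset $\{l_1,\ldots,l_m\}$ of $\{1,\ldots,r\}$ such that $\hat{P} = M_{l_1} \times \cdots \times M_{l_m}$, where each $M_{l_k} \leq U_{l_k}$ is a direct sum of isomorphic $\mathbb{Z}_pQ$-submodules of type $P_{l_k}$. Conversely, the subgroups of $G$ described in (i), (ii) and (iii) are normal in $G$.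
   Context: $G=P\rtimes_\theta Q$ is the semidirect product with respect to the action homomorphism $\theta: Q\to \mathrm{Aut}(P)$; $P$ is regarded as a $\mathbb{Z}_pQ$-module, where $\mathbb{Z}_p$ is the field with $p$ elements, via this (conjugation) action, and $\mathrm{Ker}(\theta)\le Q$ is viewed as a subgroup of $G$. An $R$-module $M$ is isotypic of type $V$ (with $V$ irreducible) if it is isomorphic to a direct sum of copies of $V$; its multiplicity is the number of copies. A submodule being ''of type $P_i$'' as a summand means it is isomorphic to $P_i$. $C_P(\hat Q)$ is the set of elements of $P$ commuting with every element of $\hat Q$. A complement of $C_P(\hat{Q})$ in $P$ is a subgroup $K\le P$ with $P=C_P(\hat Q)\times K$. $\hat P\rtimes\hat Q$ denotes the internal semidirect product $\hat P\hat Q$. *)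

(* Defs.v *)
From HB Require Import structures.
From mathcomp Require Import all_boot all_order all_fingroup all_algebra.
From mathcomp Require Import all_solvable all_field all_character.

Set Implicit Arguments.
Unset Strict Implicit.
Unset Printing Implicit Defensive.

Import GroupScope GRing.Theory.

Section SemidirectModules.

Variables (gT : finGroupType) (p : nat) (Q : {group gT}).

(* Inside G, y in Q acts on P by right conjugation x |-> x ^ y = y^-1 * x * y,
   consistently with the left-to-right composition of permutations, for which
   theta is a homomorphism.  Elements of [Aut P] are permutations of gT that
   fix every element outside P, so theta is determined by the last clause. *)
Definition semidirect_via (P : {group gT}) (theta : {morphism Q >-> {perm gT}})
    (G : {group gT}) : Prop :=
  [/\ P ><| Q = G, theta @* Q \subset Aut P
    & {in P & Q, forall x y, x ^ y = theta y x}].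

(* For M an elementary abelian p-group, scalar multiplication by k in Z_p is
   x |-> x ^+ k, so Z_pQ-submodules are exactly the Q-invariant subgroups. *)
Definition submodule (A M : {group gT}) : bool :=
  (M \subset A) && (Q \subset 'N(M)).

(* A Z_pQ-module is a representation V of Q over 'F_p, acting on row vectors
   on the right.  Additive maps between 'F_p-spaces are 'F_p-linear, so an
   equivariant group isomorphism is an isomorphism of Z_pQ-modules. *)
Definition of_type (V : representation 'F_p Q) (M : {group gT}) : Prop :=
  exists2 f : {morphism [set: 'rV['F_p]_(rdegree V)] >-> gT},
    isom [set: 'rV['F_p]_(rdegree V)] M f
    & forall u, {in Q, forall y, f (u *m V y)%R = f u ^ y}.

Definition isotypic (V : representation 'F_p Q) (m : nat) (M : {group gT}) :=
  of_type (muln_grepr V m) M.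

(* The family is nonempty, so that M is not trivial when V is irreducible. *)
Definition direct_sum_of_type (V : representation 'F_p Q) (M : {group gT}) :=
  exists (n : nat) (W : 'I_n.+1 -> {group gT}),
    \big[dprod/1]_(k < n.+1) W k = M
    /\ forall k, submodule M (W k) /\ of_type V (W k).

Definition typed_decomposition (r : nat) (V : 'I_r -> representation 'F_p Q)
    (U : 'I_r -> {group gT}) (A : {group gT}) : Prop :=
  exists (I : {set 'I_r}) (M : 'I_r -> {group gT}),
    \big[dprod/1]_(i in I) M i = A
    /\ {in I, forall i, M i \subset U i /\ direct_sum_of_type (V i) (M i)}.

End SemidirectModules.

(* Main.v *)
Require Import Defs.
From HB Require Import structures.
From mathcomp Require Import all_boot all_order all_fingroup all_algebra.
From mathcomp Require Import all_solvable all_field all_character.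

Set Implicit Arguments.
Unset Strict Implicit.
Unset Printing Implicit Defensive.

Import GroupScope GRing.Theory.

(** A normal subgroup S of G = P Q meets the normal Hall subgroup P and the Hall
    subgroup Q in Hall subgroups of S, so S is the semidirect product of A = P
    :&: S by B = Q :&: S, and A is a submodule of P.  As B acts coprimely on the
    abelian group P, [~: P, B] is a complement of C_P(B) in P; it is contained in
    S because S is normal.  Hence every normal subgroup has the shape (iii)
    ([normal_sdprod_Hall], [normal_contains_complement]) as soon as submodules of
    P are shown to have a typed decomposition.

    For that ([submodule_typed_decomposition]), Maschke's theorem writes a
    submodule A as a direct product of simple submodules W, so the point is that
    each simple W lies in a single U i and has the type of that U i
    ([simple_sub_isotypic]).  The argument is carried by homomorphisms from P to
    the irreducible modules V i.  They separate the points of P, because P is a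
    direct product of the U i and each U i is a sum of copies of V i
    ([bigdprod_separates]); hence some such homomorphism is nonzero on W, and
    Schur's lemma gives W the type V i ([schur_of_type]).  If W were not
    contained in U i, its projection to the product of the other U j would be
    nontrivial, and the same reasoning would give W a second type V j, against
    the assumption that V i and V j are not isomorphic.

    Conversely, a subgroup is normal in G once P and Q normalise it.  Since P and
    Q are abelian this is immediate for submodules and for subgroups of the
    kernel of the action.  In shape (iii), P is generated by C_P(B), which
    centralises B, and by a subgroup of A ([sdprod_normal_of_complement]). *)

(** * Module homomorphisms and the lemma of Schur *)

Section Homomorphisms.

Variables (gT : finGroupType) (p : nat) (Q : {group gT}).
Implicit Types (V : representation 'F_p Q) (W A B : {group gT}).

(** A Z_pQ-homomorphism from a multiplicatively written module W to the row
    vectors of V.  It is a plain function constrained on W only, so that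
    restricting it to a submodule does not change its type. *)
Definition intertwines V (W : {set gT})
    (h : gT -> 'rV['F_p]_(rdegree V)) : Prop :=
  {in W &, forall x y, h (x * y) = (h x + h y)%R}
  /\ {in W & Q, forall x y, h (x ^ y) = (h x *m V y)%R}.
Arguments intertwines V W h : clear implicits.

Lemma intertwinesS V W (A : {set gT}) h :
  A \subset W -> intertwines V W h -> intertwines V A h.
Proof.
move=> /subsetP sAW [hM hQ]; split=> x y /sAW Wx; first by move/sAW; apply: hM.
exact: hQ.
Qed.

(** Over the prime field a subgroup of row vectors is a subspace, so a stable
    subgroup is the row space of a submodule matrix. *)
Lemma irreducible_stable_group V (L : {group 'rV['F_p]_(rdegree V)}) :
    mx_irreducible V -> {in L & Q, forall u y, (u *m V y)%R \in L} ->
  L :!=: 1 -> L :=: [set: 'rV['F_p]_(rdegree V)].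
Proof.
case=> _ _ irrV stabL ntL.
have modL: mxmodule V (rowg_mx L).
  apply/mxmoduleP=> y Qy; apply/row_subP=> i; rewrite row_mul.
  have: row i (rowg_mx L) \in rowg (rowg_mx L) by rewrite mem_rowg row_sub.
  by rewrite -mem_rowg rowg_mxK => Li; apply: stabL.
have:= irrV _ modL (submx1 _); rewrite rowg_mx_eq0 => /(_ ntL) full.
apply/eqP; rewrite eqEsubset subsetT -rowg1 -{1}(rowg_mxK L) rowgS; exact: full.
Qed.

(** The kernel is a proper invariant subgroup of a minimal one. *)
Lemma schur_injective V W h :
    minnormal W Q -> intertwines V W h -> (exists2 x, x \in W & h x != 0%R) ->
  {in W &, injective h}.
Proof.
case/mingroupP=> /andP[_ nWQ] minW [hM hQ] [x0 Wx0 nzx0].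
have h1: h 1 = 0%R by apply: (addrI (h 1)); rewrite -hM ?mulg1 ?addr0.
have kerG: group_set [set x in W | h x == 0%R].
  apply/group_setP; split=> [|x y]; first by rewrite inE group1 h1 /=.
  rewrite !inE => /andP[Wx /eqP hx0] /andP[Wy /eqP hy0].
  by rewrite groupM //= hM // hx0 hy0 addr0.
pose K := Group kerG.
have sKW: K \subset W by apply/subsetP=> x; rewrite inE => /andP[].
have nKQ: Q \subset 'N(K).
  apply/subsetP=> y Qy; rewrite inE; apply/subsetP=> _ /imsetP[x Kx ->].
  move: Kx; rewrite !inE => /andP[Wx /eqP hx0].
  by rewrite memJ_norm ?(subsetP nWQ) // Wx hQ //= hx0 mul0mx.
have K1 : K :=: 1.
  apply/eqP/idPn=> ntK; have eqKW : K :=: W by apply: minW; rewrite ?ntK.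
  by move: Wx0 nzx0; rewrite -eqKW inE => /andP[_ ->].
move=> x y Wx Wy eqh; have /set1P : x * y^-1 \in [1 gT].
  rewrite -K1 inE groupM ?groupV //= hM ?groupV // eqh -hM ?groupV //.
  by rewrite mulgV h1.
by move/(canRL (mulgKV y)); rewrite mul1g.
Qed.

(** The image of W is a nonzero stable subgroup of V, hence everything; the
    inverse of the homomorphism then exhibits the type of W. *)
Lemma schur_of_type V W h :
    mx_irreducible V -> minnormal W Q -> intertwines V W h ->
    (exists2 x, x \in W & h x != 0%R) ->
  of_type V W.
Proof.
move=> irrV minW homh nzh; have injh := schur_injective minW homh nzh.
have [hM hQ] := homh; have /mingroupP[/andP[_ nWQ] _] := minW.
have hM' : {in W &, {morph h : x y / x * y}} by move=> x y Wx Wy; rewrite hM.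
pose f := Morphism hM'; have injf : 'injm f by apply/injmP.
have imf : f @* W = setT.
  have imfE u : u \in f @* W -> exists2 x, x \in W & u = h x.
    by case/morphimP=> x Wx _ ->; exists x.
  apply: (@irreducible_stable_group V (f @* W)%G irrV).
    move=> _ y /imfE[x Wx ->] Qy; rewrite -hQ //.
    by apply: (mem_morphim f); rewrite memJ_norm // (subsetP nWQ).
  have [x Wx nzx] := nzh; apply: contraNneq nzx => /= triv.
  by have := mem_morphim f Wx Wx; rewrite triv => /set1P fx1; apply/eqP.
have isof : isom W [set: 'rV['F_p]_(rdegree V)] f by apply/isomP.
exists (isom_inv isof); first exact: isom_sym.
move=> u y Qy; have : u \in f @* W by rewrite imf inE.
case/morphimP=> x Wx _ ->{u}; have Wxy: x ^ y \in W.
  by rewrite memJ_norm // (subsetP nWQ).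
have -> : (f x *m V y)%R = f (x ^ y) by rewrite /= -hQ.
have fK z : z \in W -> isom_inv isof (f z) = z by move=> Wz; apply: invmE.
exact: (etrans (fK _ Wxy) (congr1 (conjg^~ y) (esym (fK _ Wx)))).
Qed.

Lemma card_of_type V W : prime p -> of_type V W -> #|W| = (p ^ rdegree V)%N.
Proof.
move=> p_pr [f /isomP[/card_injm injf <-] _].
by rewrite injf // cardsT card_mx card_Fp // mul1n.
Qed.

(** The type of a module determines the representation up to similarity: the
    composite g of one parametrisation of W with the inverse of the other is
    additive, hence linear over the prime field, and its matrix is the required
    intertwiner. *)
Lemma of_type_rsim V1 V2 W :
  prime p -> of_type V1 W -> of_type V2 W -> mx_rsim V1 V2.
Proof.
move=> p_pr typ1 typ2; have eqn: rdegree V1 = rdegree V2.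
  have := card_of_type p_pr typ1; rewrite (card_of_type p_pr typ2).
  by move/eqP; rewrite eqn_exp2l ?prime_gt1 // => /eqP.
have [f1 /isomP[inj1 im1] eq1] := typ1; have [f2 /isomP[inj2 im2] eq2] := typ2.
have im12 u : f1 u \in f2 @* setT by rewrite im2 -im1 mem_morphim ?inE.
pose g u := invm inj2 (f1 u).
have f2g u : f2 (g u) = f1 u by rewrite /g invmK.
have injf2 u v : f2 u = f2 v -> u = v by move/(injmP inj2); apply; rewrite inE.
have injf1 u v : f1 u = f1 v -> u = v by move/(injmP inj1); apply; rewrite inE.
have gD : {morph g : u v / (u + v)%R}.
  move=> u v; apply: injf2; rewrite f2g -!FinRing.zmodMgE.
  by rewrite !morphM ?inE // !f2g.
have g0 : g 0%R = 0%R by apply: (addrI (g 0%R)); rewrite -gD !addr0.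
have gZ a u : g (a *: u)%R = (a *: g u)%R.
  rewrite -[a]natr_Zp !scaler_nat; elim: (val a) => [|k IHk]; first by rewrite g0.
  by rewrite !mulrS gD IHk.
pose B := (\matrix_i g (delta_mx 0 i))%R.
have gB u : g u = (u *m B)%R.
  rewrite {1}[u]row_sum_delta mulmx_sum_row.
  rewrite (big_morph g gD g0); apply: eq_bigr => i _.
  by rewrite gZ rowK.
exists B => //.
  apply/inj_row_free=> u uB0; apply: injf1.
  by rewrite -!f2g !gB uB0 mul0mx.
move=> y Qy; apply/row_matrixP=> i; rewrite !row_mul -gB; apply: injf2.
by rewrite f2g rowE eq1 // -f2g eq2 // gB -rowE.
Qed.

End Homomorphisms.
Arguments intertwines {gT p Q} V W h.

(** * Complete reducibility *)

Section Reducibility.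

Variables (gT : finGroupType) (p : nat) (Q : {group gT}).
Implicit Types (A B W : {group gT}).

(** Maschke's theorem, in the form of a splitting: W has a complement in A, so
    by Gaschutz it has a complement L in A Q, and L :&: A is a complement of W in
    A that is normalised by L and by the abelian group A, hence by Q. *)
Lemma abelem_Maschke A W :
    p.-abelem A -> p^'.-group Q -> Q \subset 'N(A) ->
    W \subset A -> Q \subset 'N(W) ->
  exists2 B : {group gT}, W \x B = A & Q \subset 'N(B).
Proof.
move=> abelA p'Q nAQ sWA nWQ; have abA := abelem_abelian abelA.
have abW := abelianS sWA abA.
have sAAQ : A \subset A <*> Q by apply: joing_subl.
have nWAQ : W <| A <*> Q.
  rewrite /normal (subset_trans sWA sAAQ) join_subG nWQ andbT.
  exact: sub_abelian_norm.
have coWQ : coprime #|W| #|A <*> Q : A|.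
  rewrite -card_quotient ?join_subG ?normG //= quotientYidl //.
  apply: (@pnat_coprime p); last exact: quotient_pgroup.
  exact: (pgroupS sWA (abelem_pgroup abelA)).
have: [splits A <*> Q, over W].
  by rewrite (Gaschutz_split nWAQ sWA sAAQ abW coWQ) (abelem_splits abelA sWA).
case/splitsP=> L /complP[tiWL defAQ]; pose B := (L :&: A)%G.
have defA : W * B = A.
  (* Dedekind's modular law *)
  by rewrite /= group_modl // defAQ; apply/setIidPr.
have sBA : B \subset A by apply: subsetIr.
exists B.
  rewrite dprodE //; first by rewrite (sub_abelian_cent2 abA).
  by apply/trivgP; rewrite -tiWL setIS ?subsetIl.
have nBW : W \subset 'N(B) by apply: subset_trans sWA (sub_abelian_norm abA sBA).
have nBL : L \subset 'N(B).
  rewrite normsI ?normG // (subset_trans _ (_ : A <*> Q \subset _)) //.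
    by rewrite -defAQ mulG_subr.
  by rewrite join_subG normG.
apply: subset_trans (joing_subr A Q) _.
by rewrite -defAQ mulG_subG nBW.
Qed.

Lemma abelem_semisimple A :
    p.-abelem A -> p^'.-group Q -> Q \subset 'N(A) ->
  exists2 s : seq {group gT}, \big[dprod/1]_(W <- s) W = A
    & {in s, forall W, minnormal W Q}.
Proof.
move=> abelA p'Q; have [n] := ubnP #|A|; elim: n A abelA => // n IHn A abelA.
rewrite ltnS => leAn nAQ; have [A1 | ntA] := eqVneq (A : {set gT}) 1.
  by exists [::] => //; rewrite big_nil A1.
have [W minW sWA] := minnormal_exists ntA nAQ.
have /mingroupP[/andP[ntW nWQ] _] := minW.
have [B defA nBQ] := abelem_Maschke abelA p'Q nAQ sWA nWQ.
have [_ defA' _ _] := dprodP defA.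
have sBA : B \subset A by rewrite -defA' mulG_subr.
have [|s defB mins] := IHn B (abelemS sBA abelA) _ nBQ.
  apply: leq_trans leAn; rewrite -(dprod_card defA) ltn_Pmull ?cardG_gt0 //.
  by rewrite cardG_gt1.
by exists (W :: s) => [|X /predU1P[->|/mins]] //; rewrite big_cons defB.
Qed.

End Reducibility.

(** * Homomorphisms to irreducible modules separate points *)

Section Separation.

Variables (gT : finGroupType) (p : nat) (Q : {group gT}).
Implicit Types (V : representation 'F_p Q) (A B P W : {group gT}).

Definition maps_separate V (X : representation 'F_p Q) : Prop :=
  forall u : 'rV_(rdegree X), u != 0%R ->
  exists g : 'rV_(rdegree X) -> 'rV_(rdegree V),
    [/\ {morph g : v w / (v + w)%R},
        forall v y, g (v *m X y)%R = (g v *m V y)%R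
      & g u != 0%R].

Lemma maps_separate_dadd V X :
  maps_separate V X -> maps_separate V (dadd_grepr V X).
Proof.
move=> sepX u nzu.
have split_act (v : 'rV_(rdegree V + rdegree X)) y :
    (v *m dadd_grepr V X y
     = row_mx (lsubmx v *m V y) (rsubmx v *m X y))%R.
  by rewrite -{1}[v]hsubmxK /= mul_row_block !mulmx0 addr0 add0r.
have [nzl | /negPn/eqP l0] := boolP (lsubmx u != 0%R).
  exists lsubmx; split=> // [v w | v y]; first exact: raddfD.
  by rewrite split_act row_mxKl.
have [|g [gD gQ gnz]] := sepX (rsubmx u).
  by apply: contraNneq nzu => r0; rewrite -[u]hsubmxK l0 r0 row_mx0.
exists (fun v => g (rsubmx v)); split=> // [v w | v y].
  by rewrite -gD; congr g; apply: raddfD.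
by rewrite split_act row_mxKr gQ.
Qed.

Lemma maps_separate_muln V n : maps_separate V (muln_grepr V n).
Proof.
rewrite /muln_grepr; elim: n => [|n IHn].
  by rewrite big_ord0 => u; rewrite [u]thinmx0 eqxx.
by rewrite big_ord_recl; apply: maps_separate_dadd.
Qed.

Lemma isotypic_separates V n W x :
    Q \subset 'N(W) -> isotypic V n W -> x \in W -> x != 1 ->
  exists2 h, intertwines V W h & h x != 0%R.
Proof.
move=> nWQ [f /isomP[injf imf] fQ] Wx ntx.
have imfW z : z \in W -> z \in f @* setT by rewrite imf.
pose k := invm injf; have fk z : z \in W -> f (k z) = z by move/imfW; apply: invmK.
have kf u : k (f u) = u by apply: invmE; rewrite inE.
have [|g [gD gQ gnz]] := maps_separate_muln (u := k x).
  apply: contraNneq ntx => kx0; rewrite -(fk x Wx) kx0; apply/eqP.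
  exact: (morph1 f).
exists (g \o k) => //; split=> [y z Wy Wz | z y Wz Qy] /=.
  rewrite -gD -FinRing.zmodMgE; congr g.
  by apply: morphM; apply: imfW.
by rewrite -{1}(fk z Wz) -fQ // kf gQ.
Qed.

(** The projection of A \x B to B, which [remgr A B] computes, commutes with the
    action of Q because both factors are invariant. *)
Lemma intertwines_proj V A B P h :
    A \x B = P -> Q \subset 'N(A) -> Q \subset 'N(B) ->
  intertwines V B h -> intertwines V P (h \o remgr A B).
Proof.
move=> defP nAQ nBQ [hM hQ]; have [_ defAB cAB tiAB] := dprodP defP.
have complB : B \in [complements to A in P] by apply/complP.
have nsAP : A <| P by have /dprod_normal2[] := defP.
have memB x : x \in P -> remgr A B x \in B by rewrite -defAB; apply: mem_remgr.
split=> [x y Px Py | x y Px Qy] /=.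
  by rewrite (remgrM complB nsAP) // hM ?memB.
rewrite -hQ ?memB //; congr h; rewrite {1}(divgr_eq A B x) conjMg.
rewrite (remgrMid tiAB) // memJ_norm ?(subsetP nAQ) ?(subsetP nBQ) ?memB //.
by rewrite mem_divgr // defAB.
Qed.

Lemma bigdprod_norm (I : Type) (s : seq I) (U : I -> {group gT}) P :
    (forall i, Q \subset 'N(U i)) ->
  \big[dprod/1]_(i <- s) U i = P -> Q \subset 'N(P).
Proof.
move=> nUQ; elim: s P => [|i s IHs] P.
  by rewrite big_nil => <-; rewrite norms1.
rewrite big_cons => defP; have [[_ H _ defH] <- _ _] := dprodP defP.
by rewrite defH normsM // IHs.
Qed.

(** A nontrivial element has a nontrivial component in some factor, and
    homomorphisms defined on a factor extend to P through the projection. *)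
Lemma bigdprod_separates (I : eqType) (s : seq I) (V : I -> representation 'F_p Q)
    (m : I -> nat) (U : I -> {group gT}) P x :
    (forall i, Q \subset 'N(U i)) -> (forall i, isotypic (V i) (m i) (U i)) ->
    \big[dprod/1]_(i <- s) U i = P -> x \in P -> x != 1 ->
  exists2 i, i \in s & exists2 h, intertwines (V i) P h & h x != 0%R.
Proof.
move=> nUQ isoU; elim: s P x => [|i s IHs] P x.
  by rewrite big_nil => <- /set1P ->; rewrite eqxx.
rewrite big_cons => defP Px ntx; have [[_ H _ defH] defUH _ tiUH] := dprodP defP.
rewrite defH in defP defUH tiUH.
have nHQ := bigdprod_norm nUQ defH.
have [x1 | ntx1] := eqVneq (remgr (U i) H x) 1.
  have Ux: x \in U i.
    by rewrite (divgr_eq (U i) H x) x1 mulg1 mem_divgr // defUH.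
  have [h homh nzh] := isotypic_separates (nUQ i) (isoU i) Ux ntx.
  exists i; first exact: mem_head.
  exists (h \o remgr H (U i)); last by rewrite /= remgr_id // setIC.
  by apply: intertwines_proj homh => //; rewrite dprodC.
have Hx1 : remgr (U i) H x \in H by rewrite mem_remgr // defUH.
have [j sj [h homh nzh]] := IHs H _ defH Hx1 ntx1.
exists j; first by rewrite inE sj orbT.
by exists (h \o remgr (U i) H) => //; apply: intertwines_proj homh.
Qed.

End Separation.

(** * Simple submodules and typed decompositions *)

Section IsotypicComponents.

Variables (gT : finGroupType) (p : nat) (Q P : {group gT}) (I : finType).
Variables (V : I -> representation 'F_p Q) (m : I -> nat).
Variable U : I -> {group gT}.

Hypothesis p_pr : prime p.
Hypothesis irrV : forall i, mx_irreducible (V i).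
Hypothesis nisoV : forall i j, i != j -> ~ mx_rsim (V i) (V j).
Hypothesis nUQ : forall i, Q \subset 'N(U i).
Hypothesis isoU : forall i, isotypic (V i) (m i) (U i).
Hypothesis defP : \big[dprod/1]_i U i = P.

(** Some homomorphism from P to a V i is nonzero on W, so W has type V i.  If an
    element z of W were outside U i, a homomorphism to some V j with j != i that
    does not kill z would give W the type V j as well. *)
Lemma simple_sub_isotypic (W : {group gT}) :
    minnormal W Q -> W \subset P ->
  exists2 i, W \subset U i & of_type (V i) W.
Proof.
move=> minW sWP; have /mingroupP[/andP[ntW nWQ] _] := minW.
have{ntW} [x Wx ntx] := trivgPn _ ntW.
have Px := subsetP sWP x Wx.
have [i _ [h homh nzh]] := bigdprod_separates nUQ isoU defP Px ntx.
have typW : of_type (V i) W.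
  by apply: (schur_of_type (irrV i) minW (intertwinesS sWP homh)); exists x.
exists i => //; apply/subsetP=> z Wz; apply/idPn=> nUz.
have Pz := subsetP sWP z Wz.
(* H is the product of the other factors; z has a nontrivial component there. *)
have := defP; rewrite (bigD1 i) //= -big_filter => defPi.
have [[_ H _ defH] defUH _ tiUH] := dprodP defPi.
rewrite defH in defPi defUH tiUH.
have Hz1 : remgr (U i) H z \in H by rewrite mem_remgr // defUH.
have ntz1 : remgr (U i) H z != 1.
  apply: contraNneq nUz => z1; rewrite (divgr_eq (U i) H z) z1 mulg1.
  by rewrite mem_divgr // defUH.
have [j] := bigdprod_separates nUQ isoU defH Hz1 ntz1.
rewrite mem_filter => /andP[neq_ji _] [k homk nzk].
apply: (nisoV neq_ji); apply: (@of_type_rsim _ _ _ _ _ W) => //.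
have homP := intertwines_proj defPi (nUQ i) (bigdprod_norm nUQ defH) homk.
by apply: (schur_of_type (irrV j) minW (intertwinesS sWP homP)); exists z.
Qed.

End IsotypicComponents.

Section Decomposition.

Variables (gT : finGroupType) (p : nat) (Q : {group gT}).

Lemma bigdprod_mem_sub (s : seq {group gT}) (M W : {group gT}) :
  \big[dprod/1]_(X <- s) X = M -> W \in s -> W \subset M.
Proof.
move=> defM sW; have := defM; rewrite (big_rem _ sW) => /dprodP[[_ H _ ->] <- _ _].
exact: mulG_subl.
Qed.

Lemma seq_direct_sum_of_type (X : representation 'F_p Q) (s : seq {group gT})
    (M : {group gT}) :
    s != [::] -> \big[dprod/1]_(W <- s) W = M ->
    {in s, forall W : {group gT}, Q \subset 'N(W) /\ of_type X W} ->
  direct_sum_of_type X M.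
Proof.
case: s => // W0 s _ defM typs.
exists (size s), (fun k => nth 1%G (W0 :: s) k); split.
  by rewrite -defM (big_nth 1%G) big_mkord.
move=> k; have sk : nth 1%G (W0 :: s) k \in W0 :: s by rewrite mem_nth.
have [nWQ typW] := typs _ sk; split=> //; rewrite /submodule nWQ andbT.
exact: bigdprod_mem_sub defM sk.
Qed.

(** A direct product of sets takes a group as value only when its factors are
    groups; this names them. *)
Lemma bigdprod_group (I : finType) (A : {set I}) (D : I -> {set gT}) (G : {group gT}) :
    \big[dprod/1]_(i in A) D i = G ->
  exists M : I -> {group gT}, {in A, forall i, D i = M i}.
Proof.
move=> defG; have groupD i : exists M : {group gT}, i \in A -> D i = M.
  have [Ai | _] := boolP (i \in A); last by exists 1%G.
  by move: defG; rewrite (bigD1 i) //= => /dprodP[[M _ defM _] _ _ _]; exists M.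
by have [M defM] := fin_all_exists groupD; exists M.
Qed.

(** Simple factors of A are grouped according to the component c k of P that
    contains them.  Only indices in the image J of c are kept, so every group of
    factors is nonempty, as [direct_sum_of_type] demands. *)
Lemma submodule_typed_decomposition (P A : {group gT}) (r : nat)
    (V : 'I_r -> representation 'F_p Q) (m : 'I_r -> nat)
    (U : 'I_r -> {group gT}) :
    prime p -> p.-abelem P -> p^'.-group Q ->
    (forall i, mx_irreducible (V i)) ->
    (forall i j, i != j -> ~ mx_rsim (V i) (V j)) ->
    (forall i, Q \subset 'N(U i)) -> (forall i, isotypic (V i) (m i) (U i)) ->
    \big[dprod/1]_(i < r) U i = P -> submodule Q P A ->
  typed_decomposition V U A.
Proof.
move=> p_pr abelP p'Q irrV nisoV nUQ isoU defP /andP[sAP nAQ].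
have [s defA simple_s] := abelem_semisimple (abelemS sAP abelP) p'Q nAQ.
have sWA (W : {group gT}) : W \in s -> W \subset A.
  exact: bigdprod_mem_sub defA.
pose W (k : 'I_(size s)) := tnth (in_tuple s) k.
have sW k : W k \in s by apply: mem_tnth.
have typW k : exists i, W k \subset U i /\ of_type (V i) (W k).
  have sWP := subset_trans (sWA _ (sW k)) sAP.
  have [i] := simple_sub_isotypic p_pr irrV nisoV nUQ isoU defP
                (simple_s _ (sW k)) sWP.
  by exists i.
have{typW} [c typW] := fin_all_exists typW.
pose J := c @: 'I_(size s).
have defAJ : \big[dprod/1]_(i in J) \big[dprod/1]_(k | c k == i) W k = A.
  rewrite -defA [RHS]big_tnth [RHS](partition_big c [in J]) //.
  by move=> k _; apply: imset_f.
have [M defM] := bigdprod_group defAJ.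
exists J, M; split; first by rewrite -defAJ; apply: eq_bigr => i /defM.
move=> i Ji; have := defM i Ji.
rewrite -big_filter -(big_map W xpredT (fun X : {group gT} => X : {set gT})).
set t := map W _ => defMi.
have typt X : X \in t -> [/\ Q \subset 'N(X), X \subset U i & of_type (V i) X].
  case/mapP=> k; rewrite mem_filter => /andP[/eqP <- _] ->.
  have [sWU tW] := typW k; split=> //.
  by have /mingroupP[/andP[]] := simple_s _ (sW k).
split.
  rewrite -(bigdprodWY defMi) gen_subG.
  rewrite big_tnth; apply/bigcupsP=> k _.
  by have [] := typt _ (mem_tnth k (in_tuple t)).
apply: seq_direct_sum_of_type defMi _; last by move=> X /typt[].
have /imsetP[k _ def_i] := Ji.
have tk: W k \in t by rewrite map_f // mem_filter def_i eqxx mem_index_enum.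
by apply: contraTneq tk => ->.
Qed.

End Decomposition.

(** * Normal subgroups of the semidirect product *)

Section NormalSubgroups.

Variables (gT : finGroupType) (P Q G : {group gT}).

Hypothesis defG : P ><| Q = G.
Hypothesis abelianP : abelian P.
Hypothesis abelianQ : abelian Q.
Hypothesis coPQ : coprime #|P| #|Q|.

Lemma sub_sdprod_normal (S : {group gT}) :
  S \subset G -> P \subset 'N(S) -> Q \subset 'N(S) -> S <| G.
Proof.
by case/sdprod_context: defG => _ _ <- _ _ sSG nSP nSQ; rewrite /normal sSG mulG_subG nSP.
Qed.

Lemma submodule_normal (S : {group gT}) : submodule Q P S -> S <| G.
Proof.
case/andP=> sSP nSQ; apply: sub_sdprod_normal => //.
  by rewrite (subset_trans sSP) // -(sdprodW defG) mulG_subl.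
exact: sub_abelian_norm.
Qed.

Lemma sub_cent_normal (S : {group gT}) : S \subset 'C_Q(P) -> S <| G.
Proof.
rewrite subsetI => /andP[sSQ cPS]; apply: sub_sdprod_normal.
- by rewrite (subset_trans sSQ) // -(sdprodW defG) mulG_subr.
- by rewrite cents_norm // centsC.
exact: sub_abelian_norm.
Qed.

(** The containment of K in A is what makes P normalise S: the remaining part
    C_P(B) of P centralises B, and it normalises A because P is abelian. *)
Lemma sdprod_normal_of_complement (A B K S : {group gT}) :
    A ><| B = S -> submodule Q P A -> B \subset Q ->
    'C_P(B) \x K = P -> K \subset A ->
  S <| G.
Proof.
move=> defS /andP[sAP nAQ] sBQ defP sKA.
have defAB := sdprodW defS.
have sAS : A \subset S by rewrite -defAB mulG_subl.
have sBS : B \subset S by rewrite -defAB mulG_subr.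
apply: sub_sdprod_normal.
- by rewrite -defAB -(sdprodW defG) mulgSS.
- rewrite -(dprodW defP) mulG_subG; apply/andP; split.
    rewrite -defAB normsM ?(sub_abelian_norm abelianP sAP) //.
      by rewrite (subset_trans (subsetIl _ _)) // sub_abelian_norm.
    by rewrite cents_norm // subsetIr.
  by rewrite (subset_trans sKA) // (subset_trans sAS) ?normG.
by rewrite -defAB normsM // sub_abelian_norm.
Qed.

(** Hall subgroups of G intersect a normal subgroup in Hall subgroups of it. *)
Lemma normal_sdprod_Hall (S : {group gT}) :
  S <| G -> (P :&: S) ><| (Q :&: S) = S.
Proof.
move=> nsSG; have [nsPG sQG _ _ _] := sdprod_context defG.
have [sPG _] := andP nsPG.
have piP : \pi(P).-Hall(G) P.
  rewrite /pHall sPG pgroup_pi -divgS // -(sdprod_card defG) mulKn ?cardG_gt0 //.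
  by rewrite -coprime_pi' ?cardG_gt0.
have piQ : \pi(P)^'.-Hall(G) Q.
  rewrite /pHall sQG -divgS // -(sdprod_card defG) mulnK ?cardG_gt0 //.
  by rewrite pnatNK /pgroup -coprime_pi' ?cardG_gt0 // coPQ; apply: pgroup_pi.
have HP := Hall_setI_normal nsSG piP; have HQ := Hall_setI_normal nsSG piQ.
apply/(sdprod_normal_p'HallP _ HQ) => //.
by rewrite /= setIC (normalGI (normal_sub nsSG)).
Qed.

(** The complement is [~: P, B] for B = Q :&: S.  It generates P together with
    C_P(B) because B acts trivially on P / [~: P, B] and, the action being
    coprime, fixed points of that quotient lift to fixed points of P. *)
Lemma normal_contains_complement (S : {group gT}) :
    S <| G ->
  exists2 K : {group gT}, 'C_P(Q :&: S) \x K = P & K \subset P :&: S.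
Proof.
move=> nsSG; have [nsPG sQG _ nPQ _] := sdprod_context defG.
set B := (Q :&: S)%G; have sBQ : B \subset Q by apply: subsetIl.
have nPB := subset_trans sBQ nPQ.
have coPB : coprime #|P| #|B| by apply: coprimegS coPQ.
have sRP : [~: P, B] \subset P by rewrite commg_subl.
exists [~: P, B]%G; last first.
  rewrite subsetI sRP (subset_trans (commgSS (normal_sub nsPG) (subsetIr Q S))) //.
  by rewrite commg_subr normal_norm.
rewrite dprodC dprodE //=.
- apply/eqP; rewrite eqEsubset mulG_subG sRP subsetIl /=.
  have nRP : P \subset 'N([~: P, B]) by apply: commg_norml.
  rewrite -(quotientSK _ nRP) coprime_norm_quotient_cent ?commg_normr //.
  - by rewrite subsetI subxx quotient_cents2r.
  - exact: coprimeSg sRP coPB.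
  exact/abelian_sol/(abelianS sRP).
- by rewrite (sub_abelian_cent2 abelianP) ?subsetIl.
apply/trivgP; rewrite -(coprime_abel_cent_TI nPB coPB abelianP).
by apply/subsetP=> x /setIP[Rx /setIP[_ cBx]]; rewrite inE Rx.
Qed.

End NormalSubgroups.

(** * Classification of the normal subgroups *)

Theorem theorem4p3 (gT : finGroupType) (p q alpha beta : nat)
    (P Q G : {group gT}) (theta : {morphism Q >-> {perm gT}})
    (p_prime : prime p) (q_prime : prime q) (p_neq_q : p != q)
    (abelP : p.-abelem P) (cardP : #|P| = (p ^ alpha)%N)
    (abelQ : q.-abelem Q) (cardQ : #|Q| = (q ^ beta)%N)
    (defG : semidirect_via P theta G)
    (r : nat) (V : 'I_r -> representation 'F_p Q)
    (irrV : forall i, mx_irreducible (V i))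
    (nisoV : forall i j, i != j -> ~ mx_rsim (V i) (V j))
    (U : 'I_r -> {group gT}) (m : 'I_r -> nat)
    (modU : forall i, submodule Q P (U i))
    (isoU : forall i, isotypic (V i) (m i) (U i))
    (defP : \big[dprod/1]_(i < r) U i = P)
    (S : {group gT}) :
  S <| G <->
  [\/ submodule Q P S /\ typed_decomposition V U S,
      S \subset 'ker theta
    | exists Phat Qhat : {group gT},
        [/\ Phat ><| Qhat = S,
            submodule Q P Phat,
            exists2 K : {group gT}, 'C_P(Qhat) \x K = P & K \subset Phat,
            Qhat \subset Q
          & typed_decomposition V U Phat]].
Proof.
have [defPQ _ thetaJ] := defG; have abP := abelem_abelian abelP.
have abQ := abelem_abelian abelQ.
have p'Q : p^'.-group Q.
  rewrite /pgroup cardQ pnatX pnatE // inE.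
  by rewrite inE /= eq_sym p_neq_q.
have coPQ : coprime #|P| #|Q| by apply: pnat_coprime (abelem_pgroup abelP) p'Q.
have nUQ i : Q \subset 'N(U i) by have /andP[] := modU i.
split=> [nsSG | ].
  have [nsPG sQG _ nPQ _] := sdprod_context defPQ.
  have modPS : submodule Q P (P :&: S).
    by rewrite /submodule subsetIl normsI // (subset_trans sQG) ?normal_norm.
  apply: Or33; exists (P :&: S)%G, (Q :&: S)%G; split=> //.
  - exact: (normal_sdprod_Hall defPQ coPQ).
  - exact: (normal_contains_complement defPQ abP coPQ).
  - exact: subsetIl.
  exact: (submodule_typed_decomposition p_prime abelP p'Q irrV nisoV nUQ
            isoU defP modPS).
case=> [[modS _] | sSK | [A [B [defS modA [K defPK sKA] sBQ _]]]].
- exact: submodule_normal modS.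
- apply: (sub_cent_normal defPQ abQ); apply/subsetP=> y /(subsetP sSK) kerSy.
  have Qy := dom_ker kerSy; rewrite inE Qy /=; apply/centP=> x Px.
  by apply/esym/commgP/conjg_fixP; rewrite thetaJ // (mker kerSy) perm1.
exact: (sdprod_normal_of_complement defPQ abP abQ defS modA sBQ defPK sKA).
Qed.
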